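(* Consider the 93600 different 13-dot hands. For each $k$, let $N_k$ be the number of $k$-Gates hands (hands with exactly $k$ winning tiles), and let $P_k$ be the probability that 13 tiles drawn uniformly at random without replacement from the 36 dot tiles form a $k$-Gates hand. Then the following hold. (a) The hand $X_1^3X_2X_3X_4X_5X_6X_7X_8X_9^3$ is the unique 13-dot hand for which all nine of $X_1,\dots,X_9$ are winning tiles, and $P_9 = 4^9/\binom{36}{13}\approx 0.000113$. (b) There are exactly 16 hands with exactly 8 winning tiles, and $P_8\approx 0.0001$. These hands, each with its unique non-winning tile in brackets, are: $X_3^3X_4X_5X_6X_7X_8^3X_9^3$ $[X_1]$; $X_3^3X_4X_5^2X_6^2X_7^2X_8^3$ $[X_1]$; $X_3^3X_4^2X_5^2X_6^2X_7X_8^3$ $[X_1]$; $X_2X_3X_4^4X_5X_6X_7X_8X_9^3$ $[X_4]$; $X_2X_3^4X_4^2X_5X_6X_7X_8^3$ $[X_3]$; $X_2^3X_3X_4X_5X_6X_7^3X_9^3$ $[X_9]$; $X_2^3X_3X_4X_5X_6X_7^3X_8^3$ $[X_9]$; $X_2^3X_3X_4X_5X_6X_7^4X_8X_9$ $[X_7]$; $X_2^3X_3X_4X_5X_6^2X_7^4X_8$ $[X_7]$; $X_2^3X_3X_4^2X_5^2X_6^2X_7^3$ $[X_9]$; $X_2^3X_3^2X_4^2X_5^2X_6X_7^3$ $[X_9]$; $X_2^3X_3^3X_4X_5X_6X_7X_8^3$ $[X_1]$; $X_1X_2X_3^4X_4X_5X_6X_7X_8^3$ $[X_3]$; $X_1^3X_3^3X_4X_5X_6X_7X_8^3$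 $[X_1]$; $X_1^3X_2X_3X_4X_5X_6^4X_7X_8$ $[X_6]$; $X_1^3X_2^3X_3X_4X_5X_6X_7^3$ $[X_9]$. (c) $N_7=79$ and $P_7\approx 0.000942$. (d) $N_6=392$ and $P_6\approx 0.005408$. (e) $N_5=1335$ and $P_5\approx 0.014215$. (f) $N_4=2948$ and $P_4\approx 0.029812$. (g) $N_3=6739$ and $P_3\approx 0.097559$. (h) $N_2=14493$ and $P_2\approx 0.178968$. (i) $N_1=14067$ and $P_1\approx 0.148473$. (j) $N_0=53530$ and $P_0\approx 0.524409$. Here each approximate equality $P\approx c$ means $|P-c|<10^{-6}$.
   Context: There are 36 dot tiles: 4 distinguishable physical copies of each of nine types $X_1,\dots,X_9$ ($X_j$ is the $j$-dot tile). An $m$-dot hand is a multiset of $m$ dot tiles, with copies of the same type identified. It is written $X_1^{n_1}\cdots X_9^{n_9}$ and encoded by the integer sequence $(n_1,\dots,n_9)$ with $0\le n_j\le 4$ for all $j$ and $n_1+\cdots+n_9=m$; factors with $n_j=0$ are omitted. There are 93600 different 13-dot hands. A pung is three identical tiles $X_iX_iX_i$ ($1\le i\le 9$). A chow is three consecutive tiles $X_iX_{i+1}X_{i+2}$ ($1\le i\le 7$). A 14-dot hand is a winning hand if it can be partitioned (as a multiset) into one identical pair $X_iX_i$ and four sets, each of which is a pung or a chow. For a 13-dot hand $X_1^{n_1}\cdots X_9^{n_9}$, the tile $X_j$ is a winning tile if $n_j\le 3$ and adding one $X_j$ to the hand gives a winning 14-dot hand. For $0\le k\le 9$, a $k$-Gates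 hand is a 13-dot hand for which exactly $k$ of the nine types $X_1,\dots,X_9$ are winning tiles. When 13 of the 36 physical tiles are drawn uniformly at random without replacement, the hand $X_1^{n_1}\cdots X_9^{n_9}$ occurs with probability $\binom{4}{n_1}\cdots\binom{4}{n_9}/\binom{36}{13}$. *)

(* Defs.v *)
From mathcomp Require Import all_boot all_order all_algebra.

Set Implicit Arguments.
Unset Strict Implicit.
Unset Printing Implicit Defensive.

Import Order.TTheory GRing.Theory Num.Theory.

(* The nine types are indexed from 0: the j-dot type X_j is j - 1 : tile. *)
Notation tile := 'I_9.
Definition X (j : nat) : tile := inord j.-1.

(* The four physical copies of each type. *)
Notation phys_tile := (tile * 'I_4)%type.

(* A hand is its exponent sequence (n_1, ..., n_9), with 0 <= n_j <= 4. *)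
Notation hand := {ffun tile -> 'I_5}.

Definition dots (h : hand) : nat := \sum_(j : tile) h j.

Definition hands13 : {set hand} := [set h : hand | dots h == 13].

(* Intended for sequences of nine entries, each at most 4 (inord sends larger
   values to 0). *)
Definition hand_of (e : seq nat) : hand :=
  [ffun j : tile => inord (nth 0 e j)].

(* inl i is the pung of type i; inr i is the chow of types i, i+1, i+2. *)
Notation meld := ('I_9 + 'I_7)%type.

Definition meld_tiles (s : meld) : seq nat :=
  match s with
  | inl i => nseq 3 (i : nat)
  | inr i => iota i 3
  end.

(* The multiset with multiplicities m is the sum of one pair and four sets;
   this forces it to have 14 elements. *)
Definition winning (m : tile -> nat) : bool :=
  [exists p : tile, [exists s : 4.-tuple meld, [forall j : tile,
    m j == count_mem (j : nat)
             (nseq 2 (p : nat) ++ flatten (map meld_tiles s))]]].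

Definition winning_tile (h : hand) (j : tile) : bool :=
  (h j <= 3) && winning (fun i => h i + (i == j)).

Definition winning_tiles (h : hand) : {set tile} :=
  [set j | winning_tile h j].

Definition gates (k : nat) : {set hand} :=
  [set h in hands13 | #|winning_tiles h| == k].

Definition N (k : nat) : nat := #|gates k|.

(* Drawing 13 tiles uniformly without replacement: the outcomes are the
   13-element subsets of the 36 physical tiles. *)
Definition draws : {set {set phys_tile}} :=
  [set A : {set phys_tile} | #|A| == 13].

(* inord never truncates here, there being only four copies of each type. *)
Definition hand_of_draw (A : {set phys_tile}) : hand :=
  [ffun j : tile => inord #|[set c : 'I_4 | (j, c) \in A]|].

Definition P (k : nat) : rat :=
  (#|[set A in draws | hand_of_draw A \in gates k]|%:R / #|draws|%:R)%R.

(* millionths 113 is the decimal 0.000113. *)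
Definition millionths (c : nat) : rat := (c%:R / 10%:R ^+ 6)%R.

Definition approx (p c : rat) : Prop := (`|p - c| < 10%:R ^- 6)%R.

Definition nine_gates : hand := hand_of [:: 3; 1; 1; 1; 1; 1; 1; 1; 3].

(* Exponents n_1, ..., n_9, paired with j when X_j is the bracketed tile. *)
Definition eight_gates : seq (seq nat * nat) :=
  [:: ([:: 0; 0; 3; 1; 1; 1; 1; 3; 3], 1);
      ([:: 0; 0; 3; 1; 2; 2; 2; 3; 0], 1);
      ([:: 0; 0; 3; 2; 2; 2; 1; 3; 0], 1);
      ([:: 0; 1; 1; 4; 1; 1; 1; 1; 3], 4);
      ([:: 0; 1; 4; 2; 1; 1; 1; 3; 0], 3);
      ([:: 0; 3; 1; 1; 1; 1; 3; 0; 3], 9);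
      ([:: 0; 3; 1; 1; 1; 1; 3; 3; 0], 9);
      ([:: 0; 3; 1; 1; 1; 1; 4; 1; 1], 7);
      ([:: 0; 3; 1; 1; 1; 2; 4; 1; 0], 7);
      ([:: 0; 3; 1; 2; 2; 2; 3; 0; 0], 9);
      ([:: 0; 3; 2; 2; 2; 1; 3; 0; 0], 9);
      ([:: 0; 3; 3; 1; 1; 1; 1; 3; 0], 1);
      ([:: 1; 1; 4; 1; 1; 1; 1; 3; 0], 3);
      ([:: 3; 0; 3; 1; 1; 1; 1; 3; 0], 1);
      ([:: 3; 1; 1; 1; 1; 4; 1; 1; 0], 6);
      ([:: 3; 3; 1; 1; 1; 1; 3; 0; 0], 9)].

(* Main.v *)
(** A left-to-right scan over the nine exponents decides whether a 14-dot hand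
    is winning: it suffices to remember how many chows are still open and whether
    the pair has been used. Running it on the set of all reachable configurations,
    once for the 13-dot hand and once for each type to which a tile has been added,
    turns the number of winning tiles into a function of a state updated digit
    by digit. The hands are then counted by dynamic programming on bags of states,
    equal states being merged: with all weights 1 this gives the numbers of hands,
    and with weights 'C(4, n_j) the numbers of draws, because a hand arises from
    \prod_j 'C(4, n_j) draws. The lists of nine- and eight-Gates hands are complete
    since their lengths agree with the counts. *)

From Stdlib Require Import BinNat.
Require Import Defs.
From mathcomp Require Import all_boot all_order all_algebra.
From mathcomp Require Import zify ring lra.

Set Implicit Arguments.
Unset Strict Implicit.
Unset Printing Implicit Defensive.

Import Order.TTheory GRing.Theory Num.Theory.

(** * The left-to-right scan and what it decides *)

(* (x, y, q): x open chows began two tiles back and y one tile back; q tells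
   whether the pair has been used. *)
Notation config := (nat * nat * bool)%type.

(* The r copies left over by the open chows form a new chow each, except for
   those in a pung or the pair. Five copies leave room for at most one pung; ch
   tells whether a chow may still begin at this tile. *)
Definition next (ch : bool) (c : nat) (t : config) : seq config :=
  let: (x, y, q) := t in
  if x + y <= c then
    let r := c - (x + y) in
    [seq (y, r - d.1, d.2)
       | d <- [:: (0, q); (3, q)] ++ (if q then [::] else [:: (2, true); (5, true)])
       & (d.1 <= r) && (ch || (r == d.1))]
  else [::].

Fixpoint accepts (w : seq nat) (t : config) : bool :=
  if w is c :: w' then has (accepts w') (next (1 < size w') c t)
  else t == (0, 0, true).

Lemma nextP ch c x y q t : c < 6 ->
  reflect (exists a z (p : bool),
     [/\ c = 2 * p + 3 * a + x + y + z, ch || (z == 0), ~~ (q && p) & t = (y, z, q || p)])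
    (t \in next ch c (x, y, q)).
Proof.
move=> c6; rewrite /next; apply: (iffP idP).
  case: ifP => // xyc /mapP[[d q']].
  rewrite mem_filter /= => /andP[/andP[dr chr] din] ->.
  have [p [a [dE qp q'E]]] : exists (p : bool) a, [/\ d = 2 * p + 3 * a, ~~ (q && p) & q' = q || p].
    case: q din => /=; rewrite !inE; [case/orP | case/or4P] => /eqP[-> ->].
    - by exists false, 0.
    - by exists false, 1.
    - by exists false, 0.
    - by exists false, 1.
    - by exists true, 0.
    - by exists true, 1.
  exists a, (c - (x + y) - d), p; split => //; [lia | | by rewrite q'E].
  by move: chr; rewrite subn_eq0; lia.
case=> a [z [p [cE chz qp ->]]].
rewrite ifT; last by lia.
apply/mapP; exists (2 * p + 3 * a, q || p).
  rewrite mem_filter /= !cE.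
  apply/andP; split; first by case: ch chz; lia.
  (* Since [c < 6], the alternatives 0, 3, 2, 5 listed in [next] exhaust [2 * p + 3 * a]. *)
  have : a < 2 by lia.
  by case: a {cE} => [|[]] //; case: q p qp => [] [].
by congr (_, _, _) => /=; lia.
Qed.

(* a counts pungs, p is the position of the pair, and B j.+2 is the number of
   chows that begin at j; the shift makes B meaningful for chows open at i. *)
Lemma acceptsP (m : nat -> nat) (m6 : forall j, m j < 6) n : forall i x y q, i + n = 9 ->
  accepts [seq m j | j <- iota i n] (x, y, q) <->
  exists p (a B : nat -> nat),
    [/\ B i = x, B i.+1 = y, q = ~~ (i <= p < 9), B 9 = 0 /\ B 10 = 0 &
      forall j, i <= j < 9 -> m j = 2 * (p == j) + 3 * a j + B j + B j.+1 + B j.+2].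
Proof.
elim: n => [|n IH] i x y q.
  rewrite addn0 => ->; split => /=.
    move=> /eqP[-> -> ->]; exists 0, (fun=> 0), (fun=> 0); split => //; lia.
  case=> p [a [B [<- <- -> [-> ->]] _]].
  by rewrite leqNgt andNb.
rewrite addnS => in9 /=; rewrite size_map size_iota.
have -> : has (accepts [seq m j | j <- iota i.+1 n]) (next (1 < n) (m i) (x, y, q)) <->
   exists2 t, t \in next (1 < n) (m i) (x, y, q) & accepts [seq m j | j <- iota i.+1 n] t.
  by split => [/hasP|] //; move=> ?; apply/hasP.
split.
  move=> [t /(nextP _ _ _ _ _ (m6 i))[a0 [z [p0 [mi chz qp ->]]]]].
  rewrite IH; last by lia.
  case=> p [a [B [B1 B2 qE [B9 B10] mE]]].
  (* When [q] holds, the inductive [p] is only known to avoid i+1, ..., 8 and might be i, which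
     would place a second pair there; 9 lies safely outside the range. *)
  exists (if p0 then i else if q then 9 else p), (fun j => if j == i then a0 else a j),
    (fun j => if j == i then x else B j).
  split; rewrite ?eqxx //.
  - by rewrite ifF //; lia.
  - by case: p0 q qp qE {mi} => [] [] //=; lia.
  - by have [-> ->] : (9 == i) = false /\ (10 == i) = false by lia.
  move=> j /andP[ij j9].
  have [-> ->] : (j.+1 == i) = false /\ (j.+2 == i) = false by lia.
  have [->|ji] := eqVneq j i.
    by rewrite B1 B2 mi; case: p0 q qp qE {mi} => [] [] //=; lia.
  rewrite mE; last by lia.
  suff -> : ((if p0 then i else if q then 9 else p) == j) = (p == j) by [].
  by case: p0 q qp qE {mi} => [] [] //=; lia.
case=> p [a [B [Bi Bi1 qE [B9 B10] mE]]].
exists (y, B i.+2, q || (p == i)).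
  apply/nextP => //; exists (a i), (B i.+2), (p == i); split=> //.
  - by rewrite mE; lia.
  (* With fewer than two tiles to the right no chow may begin at i; then i+2 is 9 or 10, where [B]
     vanishes. *)
  - case: (ltnP 1 n) => //= n1; apply/eqP.
    by have [->|->] : i.+2 = 9 \/ i.+2 = 10 by lia.
  - by rewrite qE; lia.
rewrite IH; last by lia.
exists p, a, B; split => //; first by rewrite qE; lia.
by move=> j ij; apply: mE; lia.
Qed.

(** * From multiplicities to melds *)

Definition pungs (s : seq meld) (j : nat) : nat :=
  count (fun x : meld => if x is inl i then i == j :> nat else false) s.

(* Shifted by two, as in [acceptsP]. *)
Definition chows (s : seq meld) (j : nat) : nat :=
  count (fun x : meld => if x is inr i then i.+2 == j else false) s.

Lemma count_meld_tiles (s : seq meld) j :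
  count_mem j (flatten (map meld_tiles s)) =
    3 * pungs s j + chows s j + chows s j.+1 + chows s j.+2.
Proof.
elim: s => // x s IH; rewrite /= count_cat IH /pungs /chows /=.
by case: x => i /=; rewrite /= ?eqSS; lia.
Qed.

Lemma sum_count_mem n (s : seq nat) :
  all (gtn n) s -> \sum_(j < n) count_mem (j : nat) s = size s.
Proof.
elim: s => [_|x s IH /= /andP[xn /IH sE]]; first by rewrite big1.
rewrite big_split /= sE -add1n; congr (_ + _).
rewrite (bigD1 (Ordinal xn)) //= eqxx big1 ?addn0 // => i ix.
by apply/eqP; rewrite eqb0 eq_sym.
Qed.

Lemma sum_ord_delta n (F : nat -> nat) k : k < n -> \sum_(i < n) (i == k :> nat) * F i = F k.
Proof.
move=> kn; rewrite (bigD1 (Ordinal kn)) //= eqxx mul1n big1 ?addn0 // => i ik.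
by rewrite [_ == _](negbTE ik).
Qed.

Lemma count_flatten_nseq (T : Type) (P : pred T) (I : finType) (c : I -> nat) (f : I -> T) :
  count P (flatten [seq nseq (c i) (f i) | i <- enum I]) = \sum_i P (f i) * c i.
Proof.
rewrite count_flatten -map_comp sumnE big_map big_enum /=.
by apply: eq_bigr => i _; rewrite count_nseq.
Qed.

(** Chows begin at 0, ..., 6, so their shifted positions are 2, ..., 8. Once [B] vanishes at the
    other four places, listing each meld with its multiplicity suffices. *)
Lemma meld_seq (a B : nat -> nat) : B 0 = 0 -> B 1 = 0 -> B 9 = 0 -> B 10 = 0 ->
  exists s : seq meld, (forall j, j < 9 -> pungs s j = a j) /\
                       (forall j, j < 11 -> chows s j = B j).
Proof.
move=> B0 B1 B9 B10.
exists (flatten [seq nseq (a i) (inl i : meld) | i : 'I_9 <- enum 'I_9] ++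
        flatten [seq nseq (B i.+2) (inr i : meld) | i : 'I_7 <- enum 'I_7]).
split=> j jn.
  rewrite /pungs count_cat !count_flatten_nseq.
  by rewrite sum_ord_delta // big1 ?addn0 // => i _; rewrite mul0n.
rewrite /chows count_cat !count_flatten_nseq.
rewrite big1 => [|i _]; last by rewrite mul0n.
case: j jn => [|[|j]] jn; first by rewrite big1.
  by rewrite big1 // => i _; rewrite eqSS mul0n.
under eq_bigr do rewrite !eqSS.
have [j7|j7] := ltnP j 7; first by rewrite (sum_ord_delta (fun i => B i.+2)).
rewrite big1 => [|i _]; last by have := ltn_ord i; case: eqP => //; lia.
by have [->|->] : j = 7 \/ j = 8 by lia.
Qed.

Lemma meld_tiles_lt9 (s : seq meld) : all (gtn 9) (flatten (map meld_tiles s)).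
Proof.
elim: s => // x s IH; rewrite /= all_cat IH andbT.
by case: x => i; have := ltn_ord i; rewrite /=; lia.
Qed.

Lemma size_meld_tiles (s : seq meld) : size (flatten (map meld_tiles s)) = 3 * size s.
Proof. by elim: s => // x s IH; rewrite /= size_cat IH; case: x => i /=; lia. Qed.

(** The scan never counts melds; that there are four of them follows from the total 14 = 2 + 3 *
    4. *)
Lemma winning_accepts (m : tile -> nat) :
    (forall j, m j < 6) -> \sum_j m j = 14 ->
  winning m = accepts [seq m j | j <- enum tile] (0, 0, false).
Proof.
move=> m6 m14; pose m' k := m (inord k).
have -> : [seq m j | j <- enum tile] = [seq m' j | j <- iota 0 9].
  by rewrite -val_enum_ord -map_comp; apply: eq_map => j; rewrite /= /m' inord_val.
apply/existsP/idP => [[p /existsP[s /forallP ms]]|].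
  apply/(acceptsP (fun j => m6 _)) => //.
  exists p, (pungs s), (chows s); split.
  - by rewrite /chows; elim: (val s) => // -[].
  - by rewrite /chows; elim: (val s) => // -[].
  - by rewrite ltn_ord.
  - by split; rewrite /chows; elim: (val s) => // -[] // i l /= ->; have := ltn_ord i; lia.
  move=> j /= j9; rewrite /m' (eqP (ms _)) count_cat count_nseq count_meld_tiles inordK //=; lia.
case/(acceptsP (fun j => m6 _)) => // p [a [B [B0 B1 p9 [B9 B10] mE]]].
have {}p9 : p < 9 by lia.
have [s [sa sB]] := meld_seq a B0 B1 B9 B10.
have mcount (j : tile) : m j = count_mem (j : nat) (nseq 2 p ++ flatten (map meld_tiles s)).
  have j9 := ltn_ord j.
  rewrite count_cat count_nseq count_meld_tiles sa // !sB; try lia.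
  by have := mE j j9; rewrite /m' inord_val /=; lia.
have s4 : size s == 4.
  move: m14; rewrite (eq_bigr _ (fun j _ => mcount j)) sum_count_mem.
    by rewrite size_cat size_nseq size_meld_tiles; lia.
  by rewrite all_cat all_nseq /= p9 meld_tiles_lt9.
exists (Ordinal p9); apply/existsP; exists (Tuple s4); apply/forallP => j.
by rewrite mcount.
Qed.

(** * Winning tiles as a function of a state *)

Definition nexts (ch : bool) (c : nat) (s : seq config) : seq config :=
  undup (flatten (map (next ch c) s)).

(* (r, (s, l)): r tiles are still to be placed, s holds the configurations of the
   prefix itself, and l has one set of configurations for each earlier type to
   which a tile was added, the dead ones being dropped. *)
Notation state := (nat * (seq config * seq (seq config)))%type.

Definition state_step (ch : bool) (d : nat) (s : state) : state :=
  (s.1 - d,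
   (nexts ch d s.2.1,
    [seq t <- (if d <= 3 then nexts ch d.+1 s.2.1 else [::]) :: map (nexts ch d) s.2.2
       | t != [::]])).

(* The number of winning tiles of a hand whose prefix led to the state and whose
   remaining exponents are w. *)
Definition waits (w : seq nat) (s : state) : nat :=
  count (has (accepts w)) s.2.2 +
  count (fun j => (nth 0 w j <= 3) && has (accepts (incr_nth w j)) s.2.1) (iota 0 (size w)).

Fixpoint words (n : nat) : seq (seq nat) :=
  if n is n'.+1 then [seq d :: w | d <- iota 0 5, w <- words n'] else [:: [::]].

Lemma has_nexts w c s : has (accepts w) (nexts (1 < size w) c s) = has (accepts (c :: w)) s.
Proof.
rewrite /nexts (eq_has_r (mem_undup _)); elim: s => // t s IH.
by rewrite /= has_cat IH.
Qed.

Lemma waits_cons d w s : waits (d :: w) s = waits w (state_step (1 < size w) d s).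
Proof.
have count_alive l : count (has (accepts w)) [seq t <- l | t != [::]] = count (has (accepts w)) l.
  by rewrite count_filter; apply: eq_count => -[|t l'] //=; rewrite andbT.
rewrite /waits count_alive /= addnCA.
rewrite (iotaDl 1 0) count_map addnA; congr (_ + _); last first.
  apply: eq_in_count => j; rewrite mem_iota => /= jw.
  by rewrite -has_nexts size_incr_nth jw.
rewrite count_map; congr (_ + _).
  by case: ifP => // _; rewrite has_nexts.
by apply: eq_count => t; rewrite /= has_nexts.
Qed.

Lemma mem_words n w : (w \in words n) = (size w == n) && all (gtn 5) w.
Proof.
elim: n w => [|n IH] w; first by rewrite inE; case: w.
apply/allpairsP/idP => [[[d v] []]|].
  by rewrite mem_iota IH => /= d5 /andP[/eqP sv v5] ->; rewrite /= sv eqxx d5.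
case: w => // d w /= /andP[sw /andP[d5 w5]]; exists (d, w).
by split=> //; [rewrite (mem_iota 0 5) | rewrite IH w5 andbT -eqSS].
Qed.

Lemma uniq_words n : uniq (words n).
Proof.
elim: n => // n IH; apply: allpairs_uniq => //.
by move=> [d w] [d' w'] _ _ [-> ->].
Qed.

Lemma nat_of_binD (a b : BinNums.N) : (a + b)%num = a + b :> nat. Proof. lia. Qed.

Lemma nat_of_binM (a b : BinNums.N) : (a * b)%num = a * b :> nat. Proof. lia. Qed.

(** * Dynamic programming on bags of states *)

Section Bag.

Variables (g : nat -> BinNums.N) (Q : pred nat).

Definition value (n : nat) (s : state) : nat :=
  \sum_(w <- words n | (sumn w == s.1) && Q (waits w s)) \prod_(d <- w) g d.

(** Split off the first digit. Words whose first digit exceeds [s.1] contribute nothing, so the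
    truncated subtraction in [state_step] is harmless. *)
Lemma valueS n s :
  value n.+1 s = \sum_(d <- iota 0 5 | d <= s.1) g d * value n (state_step (1 < n) d s).
Proof.
rewrite /value big_mkcond big_allpairs_dep [RHS]big_mkcond; apply: eq_bigr => d _.
rewrite -big_mkcond; case: (leqP d s.1) => ds.
  rewrite big_distrr /= big_seq_cond [RHS]big_seq_cond.
  apply: eq_big => [w|w _]; last by rewrite big_cons.
  rewrite mem_words; case: (size w =P n) => // <-; rewrite waits_cons /=.
  by congr (_ && (_ && _)); lia.
by rewrite big1 // => w /= /andP[/eqP]; lia.
Qed.

Definition bag_sum (F : state -> nat) (b : seq (state * BinNums.N)) : nat :=
  \sum_(sc <- b) sc.2 * F sc.1.

Inductive trie := Leaf | Node of seq (state * BinNums.N) & trie & trie.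

Fixpoint bucket_add (s : state) (c : BinNums.N) (b : seq (state * BinNums.N)) :
    seq (state * BinNums.N) :=
  if b is sc :: b' then
    if sc.1 == s then (s, (c + sc.2)%num) :: b' else sc :: bucket_add s c b'
  else [:: (s, c)].

Fixpoint trie_add (k : bitseq) (s : state) (c : BinNums.N) (t : trie) : trie :=
  match t, k with
  | Leaf, [::] => Node [:: (s, c)] Leaf Leaf
  | Leaf, x :: k' =>
      let u := trie_add k' s c Leaf in if x then Node [::] u Leaf else Node [::] Leaf u
  | Node b l r, [::] => Node (bucket_add s c b) l r
  | Node b l r, x :: k' =>
      if x then Node b (trie_add k' s c l) r else Node b l (trie_add k' s c r)
  end.

Fixpoint trie_elements (t : trie) (rest : seq (state * BinNums.N)) : seq (state * BinNums.N) :=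
  if t is Node b l r then b ++ trie_elements l (trie_elements r rest) else rest.

Fixpoint trie_sum (F : state -> nat) (t : trie) : nat :=
  if t is Node b l r then bag_sum F b + (trie_sum F l + trie_sum F r) else 0.

Lemma bag_sum_bucket_add F s c b : bag_sum F (bucket_add s c b) = c * F s + bag_sum F b.
Proof.
rewrite /bag_sum; elim: b => [|[s' c'] b IH] /=; first by rewrite !big_cons big_nil.
case: eqP => [->|_]; rewrite !big_cons /= ?IH; last by rewrite addnCA.
by rewrite nat_of_binD mulnDl addnA.
Qed.

(** The sum does not see where a state is stored, so this holds for every [k]; the choice of key
    affects only how well equal states are merged. *)
Lemma trie_sum_add F k s c t : trie_sum F (trie_add k s c t) = c * F s + trie_sum F t.
Proof.
elim: k t => [|x k IH] [|b l r] /=.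
- by rewrite /bag_sum big_seq1 !addn0.
- by rewrite bag_sum_bucket_add -addnA.
- by case: x; rewrite /= IH /bag_sum big_nil /= ?addn0.
- by case: x; rewrite /= IH; lia.
Qed.

Lemma bag_sum_trie_elements F t b : bag_sum F (trie_elements t b) = trie_sum F t + bag_sum F b.
Proof.
elim: t b => //= b' l IHl r IHr b.
by rewrite /bag_sum big_cat /= -!/(bag_sum _ _) IHl IHr; lia.
Qed.

(* [key] only has to spread the states over the trie: buckets compare the states
   themselves, so it need not be injective. *)
Definition unary (n : nat) (k : bitseq) : bitseq := ncons n true (false :: k).

Definition config_key (t : config) (k : bitseq) : bitseq :=
  let: (x, y, q) := t in unary x (unary y (q :: k)).

Definition configs_key (l : seq config) (k : bitseq) : bitseq :=
  foldr (fun t k' => true :: config_key t k') (false :: k) l.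

Definition key (s : state) : bitseq :=
  unary s.1 (configs_key s.2.1 (foldr configs_key [::] s.2.2)).

Definition bag_step (ch : bool) (b : seq (state * BinNums.N)) : seq (state * BinNums.N) :=
  trie_elements (foldl (fun t sc => foldl (fun t d =>
    if d <= sc.1.1 then let s := state_step ch d sc.1 in trie_add (key s) s (g d * sc.2)%num t
    else t) t (iota 0 5)) Leaf b) [::].

Lemma bag_sum_step F ch b :
  bag_sum F (bag_step ch b) =
  bag_sum (fun s => \sum_(d <- iota 0 5 | d <= s.1) g d * F (state_step ch d s)) b.
Proof.
rewrite bag_sum_trie_elements [bag_sum F [::]]big_nil addn0.
set f := (f in foldl f).
have fE t sc : trie_sum F (f t sc) =
    trie_sum F t + sc.2 * \sum_(d <- iota 0 5 | d <= sc.1.1) g d * F (state_step ch d sc.1).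
  rewrite /f; elim: (iota 0 5) t => [|d r IH] t /=; first by rewrite big_nil muln0 addn0.
  rewrite IH big_cons; case: ifP => // _.
  by rewrite trie_sum_add nat_of_binM mulnDr; lia.
have -> t : trie_sum F (foldl f t b) = trie_sum F t + bag_sum
    (fun s => \sum_(d <- iota 0 5 | d <= s.1) g d * F (state_step ch d s)) b.
  rewrite /bag_sum; elim: b t => [|sc b IH] t; first by rewrite big_nil addn0.
  by rewrite /= IH fE big_cons addnA.
by [].
Qed.

Fixpoint bag_run (n : nat) (b : seq (state * BinNums.N)) : seq (state * BinNums.N) :=
  if n is n'.+1 then bag_run n' (bag_step (1 < n') b) else b.

Definition mass (b : seq (state * BinNums.N)) : BinNums.N :=
  foldr (fun sc r => if (sc.1.1 == 0) && Q (waits [::] sc.1) then (sc.2 + r)%num else r) 0%num b.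

(** The weighted sum of [value] over the bag is invariant: a step replaces each state by its
    successors and lowers [n] by one. At [n = 0], [value] is the indicator that [mass] adds up. *)
Lemma bag_sum_run n b : bag_sum (value n) b = mass (bag_run n b).
Proof.
elim: n b => [|n IH] b /=.
  rewrite /bag_sum /mass; elim: b => [|sc b IH]; first by rewrite big_nil.
  rewrite big_cons IH /= /value /= big_mkcond big_seq1 big_nil [0 == _]eq_sym.
  by case: ifP; rewrite ?nat_of_binD ?muln1 ?muln0.
rewrite -IH bag_sum_step; apply: eq_bigr => sc _; congr (_ * _).
exact: valueS.
Qed.

End Bag.

(** * Hands as words *)

Definition word (h : hand) : seq nat := [seq (h j : nat) | j <- enum tile].

Definition start (n : nat) : state := (n, ([:: (0, 0, false)], [::])).

Lemma nth_word h (j : tile) : nth 0 (word h) j = h j.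
Proof. by rewrite (nth_map j) ?size_enum_ord // nth_ord_enum. Qed.

Lemma size_word h : size (word h) = 9.
Proof. by rewrite size_map size_enum_ord. Qed.

Lemma word_hand_of w : (size w == 9) && all (gtn 5) w -> word (hand_of w) = w.
Proof.
move=> /andP[/eqP w9 w5]; rewrite -[RHS](mkseq_nth 0) w9 /mkseq.
rewrite -val_enum_ord -map_comp; apply: eq_map => j /=.
by rewrite ffunE inordK //; apply: (all_nthP 0 w5); rewrite w9.
Qed.

(** [word] is a bijection from hands onto [words 9], with inverse [hand_of]. *)
Lemma sum_hands (G : seq nat -> nat) :
  \sum_(h : hand) G (word h) = \sum_(w <- words 9) G w.
Proof.
rewrite -big_enum -(big_map word predT G); apply: perm_big.
apply: uniq_perm; last 1 first.
- move=> w; apply/mapP/idP => [[h _ ->]|wW]; last first.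
    by exists (hand_of w); rewrite ?mem_enum // word_hand_of // -mem_words.
  rewrite mem_words size_word /=; apply/allP => _ /mapP[j _ ->]; exact: ltn_ord.
- rewrite map_inj_uniq ?enum_uniq // => h h' hE; apply/ffunP => j; apply: val_inj.
  by rewrite /= -!nth_word hE.
- exact: uniq_words.
Qed.

Lemma sumn_word h : sumn (word h) = dots h.
Proof. by rewrite sumnE big_map big_enum. Qed.

Lemma winning_tile_accepts h (j : tile) : dots h = 13 ->
  winning_tile h j = (nth 0 (word h) j <= 3) && accepts (incr_nth (word h) j) (0, 0, false).
Proof.
move=> h13; rewrite /winning_tile nth_word winning_accepts.
- congr (_ && accepts _ _); apply: (@eq_from_nth _ 0).
    by rewrite size_map size_enum_ord size_incr_nth size_word ltn_ord.
  move=> i; rewrite size_map size_enum_ord => i9; rewrite nth_incr_nth.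
  rewrite (nth_map j) ?size_enum_ord // -[i]/(val (Ordinal i9)) nth_ord_enum nth_word addnC.
  by rewrite eq_sym.
- by move=> i; have := ltn_ord (h i); lia.
- rewrite big_split /= -/(dots h) h13 (bigD1 j) //= eqxx big1 // => i /negbTE.
  by move=> /= ->.
Qed.

Lemma card_winning_tiles h : dots h = 13 -> #|winning_tiles h| = waits (word h) (start 13).
Proof.
move=> h13; rewrite cardE /enum_mem size_filter -enumT.
rewrite /waits add0n size_word -(val_enum_ord 9) count_map.
apply: eq_count => j; have jE : (j \in winning_tiles h) = winning_tile h j by rewrite inE.
by rewrite [LHS]jE winning_tile_accepts //= orbF.
Qed.

Lemma sum_mass (g : nat -> BinNums.N) (Q : pred nat) :
  \sum_(h in hands13 | Q #|winning_tiles h|) \prod_j g (h j) =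
  mass Q (bag_run g 9 [:: (start 13, 1%num)]).
Proof.
rewrite -bag_sum_run /bag_sum big_seq1 mul1n /value [RHS]big_mkcond -sum_hands.
rewrite [LHS]big_mkcond; apply: eq_bigr => h _.
rewrite inE sumn_word; case: (dots h =P 13) => [h13|] //=.
by rewrite card_winning_tiles // /word big_map big_enum.
Qed.

(** * Physical draws *)

Lemma card_slice (A : {set phys_tile}) (j : tile) : #|[set c : 'I_4 | (j, c) \in A]| < 5.
Proof. by rewrite ltnS (leq_trans (max_card _)) // card_ord. Qed.

Lemma dots_hand_of_draw A : dots (hand_of_draw A) = #|A|.
Proof.
rewrite /dots; under eq_bigr do rewrite ffunE inordK ?card_slice // cardsE -sum1_card.
rewrite (pair_big_dep xpredT (fun j c => (j, c) \in A)) /= -sum1_card.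
by apply: eq_bigl => -[j c].
Qed.

(** A set of physical tiles is a family of nine slices, one set of copies for each type; the hand
    prescribes the sizes of the slices, which are then chosen independently. *)
Lemma card_hand_of_draw (h : hand) :
  #|[set A | hand_of_draw A == h]| = \prod_j 'C(4, h j).
Proof.
pose f (F : {ffun tile -> {set 'I_4}}) : {set phys_tile} := [set x | x.2 \in F x.1].
have f_slice F j : [set c | (j, c) \in f F] = F j.
  by apply/setP => c; rewrite !inE.
have f_inj : injective f by move=> F F' FE; apply/ffunP => j; rewrite -!f_slice FE.
pose fam (j : tile) := [set B : {set 'I_4} | #|B| == h j].
have -> : [set A | hand_of_draw A == h] = [set f F | F in family fam].
  apply/setP => A; rewrite inE; apply/eqP/imsetP => [hE|[F /familyP Fh ->]].
    exists [ffun j => [set c | (j, c) \in A]]; last first.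
      by apply/setP => -[j c]; rewrite inE /= ffunE inE.
    by apply/familyP => j; rewrite inE -hE !ffunE inordK ?card_slice.
  apply/ffunP => j; apply: val_inj; rewrite ffunE /= inordK ?card_slice // f_slice.
  by have := Fh j; rewrite inE => /eqP.
rewrite card_imset // card_family -big_enum /= -(big_map _ xpredT id) foldrE.
rewrite !big_map; apply: eq_bigr => j _.
by rewrite /fam card_draws card_ord.
Qed.

Lemma card_draws_gates k :
  #|[set A in draws | hand_of_draw A \in gates k]| =
  \sum_(h in gates k) \prod_j 'C(4, h j).
Proof.
rewrite -sum1_card (partition_big hand_of_draw (mem (gates k))) /=; last first.
  by move=> A; rewrite inE => /andP[].
apply: eq_bigr => h hk; rewrite -card_hand_of_draw -sum1_card; apply: eq_bigl => A.
rewrite [RHS]inE; case: (hand_of_draw A =P h) => [hE|_]; last by rewrite andbF.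
rewrite andbT inE hE hk andbT inE -dots_hand_of_draw hE.
by move: hk; rewrite !inE => /andP[].
Qed.

(** Climb the diagonal from 'C(23, 0) to 'C(36, 13): each entry determines the next by a linear
    equation with constant coefficients. *)
Lemma bin_36_13 : 'C(36, 13) = 2310789600%num.
Proof.
have bE n m : n.+1 * 'C(n, m) = m.+1 * 'C(n.+1, m.+1) := mul_bin_diag n.+1 m.
move: (bin0 23) (bE 23 0) (bE 24 1) (bE 25 2) (bE 26 3) (bE 27 4) (bE 28 5) (bE 29 6).
move: (bE 30 7) (bE 31 8) (bE 32 9) (bE 33 10) (bE 34 11) (bE 35 12).
lia.
Qed.

Lemma card_all_draws : #|draws| = 'C(36, 13).
Proof. by rewrite /draws card_draws card_prod !card_ord. Qed.

(** * Evaluation of the counts and probabilities *)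

Notation initial := [:: (start 13, 1%num)].

(** Bundled so that one run of the dynamic program serves the total and all ten values of k. *)
Definition masses (b : seq (state * BinNums.N)) : BinNums.N * seq BinNums.N :=
  (mass xpredT b, [seq mass (pred1 k) b | k <- iota 0 10]).

Lemma fst_masses b : (masses b).1 = mass xpredT b. Proof. by []. Qed.

Lemma nth_masses b k : k < 10 -> nth 0%num (masses b).2 k = mass (pred1 k) b.
Proof. by move=> k10; rewrite (nth_map 0) ?size_iota // nth_iota. Qed.

Definition binom4 (d : nat) : BinNums.N := nth 0%num [:: 1; 4; 6; 4; 1]%num d.

Definition hand_counts : seq BinNums.N :=
  [:: 53530; 14067; 14493; 6739; 2948; 1335; 392; 79; 16; 1]%num.

Definition draw_counts : seq BinNums.N :=
  [:: 1211798360; 343090808; 413556512; 225438896; 68889152; 32848640; 12497408; 2176256;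
      231424; 262144]%num.

Lemma masses_hands : masses (bag_run (fun=> 1%num) 9 initial) = (93600%num, hand_counts).
Proof. by vm_compute. Qed.

Lemma masses_draws : masses (bag_run binom4 9 initial) = (2310789600%num, draw_counts).
Proof. by vm_compute. Qed.

Lemma card_hands13 : #|hands13| = 93600%num.
Proof.
have := sum_mass (fun=> 1%num) xpredT; rewrite -fst_masses masses_hands => <-.
rewrite -sum1_card.
by apply: eq_big => [h|h _]; rewrite ?andbT // big1.
Qed.

Lemma sum_gates (F : hand -> nat) k :
  \sum_(h in gates k) F h = \sum_(h in hands13 | pred1 k #|winning_tiles h|) F h.
Proof. by apply: eq_bigl => h; rewrite inE. Qed.

Lemma N_hand_counts k : k < 10 -> N k = nth 0%num hand_counts k.
Proof.
move=> k10; have := sum_mass (fun=> 1%num) (pred1 k).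
rewrite -(nth_masses _ k10) masses_hands => <-.
by rewrite /N -sum1_card sum_gates; apply: eq_bigr => h _; rewrite big1.
Qed.

Lemma P_draw_counts k : k < 10 -> P k = ((nth 0%num draw_counts k)%:R / 'C(36, 13)%:R)%R.
Proof.
move=> k10; rewrite /P card_all_draws card_draws_gates.
have := sum_mass binom4 (pred1 k); rewrite -(nth_masses _ k10) masses_draws => <-.
rewrite sum_gates; congr (_%:R / _)%R; apply: eq_bigr => h _; apply: eq_bigr => j _.
by case: (h j) => [] [|[|[|[|[|]]]]].
Qed.

(** Multiplied by [d * m], the bound says that [w * m] and [c * d] differ by less than [d]; the two
    hypotheses express this without subtraction. *)
Lemma dist_ratios_lt (w d c m : nat) : 0 < d -> 0 < m ->
  w * m < (c + 1) * d -> c * d < w * m + d ->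
  (`|w%:R / d%:R - c%:R / m%:R| < m%:R^-1 :> rat)%R.
Proof.
move=> d0 m0; rewrite -!(ltr_nat rat) !natrD !natrM natrD => wd dw.
have {}d0 : (0 < d%:R :> rat)%R by rewrite ltr0n.
have {}m0 : (0 < m%:R :> rat)%R by rewrite ltr0n.
have -> : (w%:R / d%:R - c%:R / m%:R = ((w%:R * m%:R - c%:R * d%:R) / d%:R) / m%:R :> rat)%R.
  by field; rewrite !gt_eqF.
rewrite normrM normfV (gtr0_norm m0) ltr_pdivrMr // mulVf ?gt_eqF //.
rewrite normrM normfV (gtr0_norm d0) ltr_pdivrMr // ltr_norml.
by apply/andP; split; lra.
Qed.

(* [bin_of_nat] keeps large numerals from being compared in unary. *)
Lemma numeral (n : nat) (b : BinNums.N) : bin_of_nat n = b -> n = b.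
Proof. by move=> <-; rewrite bin_of_natK. Qed.

Lemma N_eq k n : k < 10 -> bin_of_nat n = nth 0%num hand_counts k -> N k = n.
Proof. by move=> k10 /numeral->; exact: N_hand_counts. Qed.

Lemma P_approx k n : k < 10 ->
  (let w := nth 0 draw_counts k in let c := bin_of_nat n in let d := 2310789600 in
   N.ltb (w * 10 ^ 6) ((c + 1) * d) && N.ltb (c * d) (w * 10 ^ 6 + d))%num ->
  approx (P k) (millionths n).
Proof.
move=> k10 /andP[/N.ltb_lt wd /N.ltb_lt dw].
rewrite (P_draw_counts k10) bin_36_13 /approx /millionths -natrX -[n]bin_of_natK.
have -> : 10 ^ 6 = (10 ^ 6)%num by lia.
by apply: dist_ratios_lt; lia.
Qed.

(** * The explicit lists of hands *)

Definition waits_on (e : seq nat) (j : nat) : bool :=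
  (nth 0 e j <= 3) && accepts (incr_nth e j) (0, 0, false).

Lemma winning_tile_hand_of (e : seq nat) (j : tile) :
  (size e == 9) && all (gtn 5) e -> sumn e = 13 -> winning_tile (hand_of e) j = waits_on e j.
Proof.
by move=> eW e13; rewrite winning_tile_accepts ?word_hand_of // -sumn_word word_hand_of.
Qed.

Lemma hand_of_gates e k :
    (size e == 9) && all (gtn 5) e -> sumn e = 13 -> count (waits_on e) (iota 0 9) = k ->
  hand_of e \in gates k.
Proof.
move=> eW e13 <-; have h13 : dots (hand_of e) = 13 by rewrite -sumn_word word_hand_of.
rewrite !inE h13 eqxx (card_winning_tiles h13) (word_hand_of eW) /waits.
have /andP[/eqP-> _] := eW; apply/eqP; apply: eq_count => j.
by rewrite /waits_on /= orbF.
Qed.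

Lemma eight_gates_check : all (fun e : seq nat * nat =>
    [&& size e.1 == 9, all (gtn 5) e.1, sumn e.1 == 13, 0 < e.2 < 10
      & all (fun j => ~~ waits_on e.1 j == (j.+1 == e.2)) (iota 0 9)]) eight_gates.
Proof. by vm_compute. Qed.

Lemma eight_gatesP e : e \in eight_gates ->
  [/\ (size e.1 == 9) && all (gtn 5) e.1, sumn e.1 = 13, 0 < e.2 < 10
    & forall j : tile, ~~ waits_on e.1 j = (j.+1 == e.2)].
Proof.
move/(allP eight_gates_check) => /and5P[-> -> /eqP-> -> /allP Hj].
split=> // j; apply/eqP/Hj; rewrite mem_iota; exact: ltn_ord.
Qed.

Lemma mem_gates8 h : (h \in gates 8) = (h \in [seq hand_of e.1 | e <- eight_gates]).
Proof.
rewrite -mem_enum; symmetry.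
have uniq8 : uniq [seq hand_of e.1 | e <- eight_gates].
  (* [word] recovers the exponents, so distinctness is computed on sequences of numbers instead of
     finite functions. *)
  rewrite (map_comp hand_of fst) map_inj_in_uniq; first by vm_compute.
  move=> _ _ /mapP[e /eight_gatesP[eW _ _ _] ->] /mapP[e' /eight_gatesP[eW' _ _ _] ->] eE.
  by rewrite -(word_hand_of eW) eE word_hand_of.
have [//||_ ->//] := uniq_min_size uniq8 (s2 := enum (gates 8)).
  move=> _ /mapP[e eE ->]; rewrite mem_enum; have [eW e13 _ _] := eight_gatesP eE.
  apply: hand_of_gates => //; apply/eqP.
  have /allP : all (fun e => count (waits_on e.1) (iota 0 9) == 8) eight_gates by vm_compute.
  exact.
by rewrite -cardE -/(N 8) N_hand_counts.
Qed.

Lemma mem_gates9 h : (h \in gates 9) = (h == nine_gates).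
Proof.
have /eqP/cards1P[x gE] : N 9 = 1 by rewrite N_hand_counts.
have : nine_gates \in gates 9 by exact: hand_of_gates.
by rewrite gE !inE => /eqP->.
Qed.

Lemma all_winning h : h \in hands13 -> (forall j, winning_tile h j) <-> h \in gates 9.
Proof.
move=> h13; rewrite inE h13 /=; split=> [hw|/eqP h9 j].
  apply/eqP; rewrite -[RHS](card_ord 9) -cardsT; congr #|pred_of_set _|.
  by apply/setP => j; rewrite !inE hw.
have : winning_tiles h == setT.
  by rewrite eqEcard subsetT cardsT card_ord h9.
by move/eqP/setP/(_ j); rewrite !inE.
Qed.

Theorem proposition5p1 :
  #|hands13| = 93600 /\
  (* (a) *)
  ((forall h : hand,
      h \in hands13 /\ (forall j : tile, winning_tile h j) <-> h = nine_gates) /\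
   P 9 = ((4 ^ 9)%N%:R / 'C(36, 13)%:R)%R /\ approx (P 9) (millionths 113)) /\
  (* (b) *)
  (N 8 = 16 /\ approx (P 8) (millionths 100) /\
   (forall h : hand,
      h \in gates 8 <-> h \in [seq hand_of e.1 | e <- eight_gates]) /\
   (forall e : seq nat * nat, e \in eight_gates ->
      forall j : tile, ~~ winning_tile (hand_of e.1) j <-> j = X e.2)) /\
  (* (c) *) (N 7 = 79 /\ approx (P 7) (millionths 942)) /\
  (* (d) *) (N 6 = 392 /\ approx (P 6) (millionths 5408)) /\
  (* (e) *) (N 5 = 1335 /\ approx (P 5) (millionths 14215)) /\
  (* (f) *) (N 4 = 2948 /\ approx (P 4) (millionths 29812)) /\
  (* (g) *) (N 3 = 6739 /\ approx (P 3) (millionths 97559)) /\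
  (* (h) *) (N 2 = 14493 /\ approx (P 2) (millionths 178968)) /\
  (* (i) *) (N 1 = 14067 /\ approx (P 1) (millionths 148473)) /\
  (* (j) *) (N 0 = 53530 /\ approx (P 0) (millionths 524409)).
Proof.
split; first by rewrite card_hands13; symmetry; apply: numeral; vm_compute.
split; first split.
- move=> h; split=> [[h13 /(all_winning h13)]|hE].
    by rewrite mem_gates9 => /eqP.
  have h9 : h \in gates 9 by rewrite mem_gates9 hE.
  have h13 : h \in hands13 by move: h9; rewrite inE => /andP[].
  by split=> //; apply/(all_winning h13).
- split; last by apply P_approx; vm_compute.
  have -> : 4 ^ 9 = 262144%num by lia.
  exact: (P_draw_counts (isT : 9 < 10)).
split; first split; first by apply N_eq; vm_compute.
- split; first by apply P_approx; vm_compute.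
  split=> [h|e eE j]; first by rewrite mem_gates8.
  have [eW e13 /andP[e0 e10] ej] := eight_gatesP eE.
  rewrite (winning_tile_hand_of _ eW e13) ej.
  (* The bounds [0 < e.2 < 10] keep the predecessor and [inord] in [X e.2] away from their default
     values. *)
  split=> [/eqP je|->]; last by rewrite inordK ?prednK // -ltnS prednK.
  by rewrite /X -je inord_val.
by do !split; (apply N_eq || apply P_approx); vm_compute.
Qed.
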